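(* For every pair of integers $\ell\ge 3$ with $\ell\neq 5$, and $r\ge 2$, the generalised H-graph $H^\ell(r)$ satisfies $\chi_\rho(H^\ell(r))=5$ if $r$ is even, and $\chi_\rho(H^\ell(r))=6$ if $r$ is odd.
   Context: All graphs are simple; $d_G(u,v)$ is the shortest-path distance. A packing $k$-colouring of $G$ is a map $\pi:V(G)\to\{1,\dots,k\}$ such that for distinct $u,v$, $\pi(u)=\pi(v)=i$ implies $d_G(u,v)>i$; $\chi_\rho(G)$ is the least $k$ for which a packing $k$-colouring exists. For integers $r\ge 2$ and $\ell\ge 1$, the generalised H-graph $H^\ell(r)$ has vertex set $\{u^i_j: 0\le i\le \ell+1,\ 0\le j\le 2r-1\}$ and edge set consisting of: $u^0_ju^0_{j+1}$ and $u^{\ell+1}_ju^{\ell+1}_{j+1}$ for $0\le j\le 2r-1$ (subscripts modulo $2r$); $u^i_{2j}u^i_{2j+1}$ for $1\le i\le \ell$, $0\le j\le r-1$; and $u^i_ju^{i+1}_j$ for $0\le i\le \ell$, $0\le j\le 2r-1$. It is 3-regular of order $2r(\ell+2)$. *)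

(* Defs.v *)
From mathcomp Require Import all_boot.
From mathcomp Require Import zify.

Set Implicit Arguments.
Unset Strict Implicit.
Unset Printing Implicit Defensive.

Record sgraph := SGraph {
  vertex :> finType;
  adj : rel vertex;
  adj_sym : symmetric adj;
  adj_irrefl : irreflexive adj }.

Section Distance.
Variable G : sgraph.
Implicit Types u v : G.

Definition walk u v (n : nat) : bool :=
  [exists p : n.-tuple G, path (@adj G) u p && (last u p == v)].

Lemma connect_walk u v : connect (@adj G) u v -> exists n, walk u v n.
Proof.
case/connectP=> p up ->; exists (size p).
by apply/existsP; exists (in_tuple p); rewrite up eqxx.
Qed.

(* [None] stands for the infinite distance between distinct components. *)
Definition dist u v : option nat :=
  match @idP (connect (@adj G) u v) with
  | ReflectT uv => Some (ex_minn (connect_walk uv))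
  | ReflectF _ => None
  end.

Definition dist_gt u v (n : nat) : bool :=
  if dist u v is Some d then n < d else true.

End Distance.

Section PackingColouring.
Variable G : sgraph.

(* The element [c] of ['I_k] encodes the colour [c.+1] of {1, ..., k}. *)
Definition packing_colouring (k : nat) (f : {ffun G -> 'I_k}) : bool :=
  [forall u : G, forall v : G,
     (u != v) && (f u == f v) ==> dist_gt u v (f u).+1].

Definition packing_colourable (k : nat) : bool :=
  [exists f : {ffun G -> 'I_k}, packing_colouring f].

Lemma ex_packing_colourable : exists k, packing_colourable k.
Proof.
exists #|G|; apply/existsP; exists [ffun u => enum_rank u].
apply/forallP=> u; apply/forallP=> v; rewrite !ffunE (inj_eq enum_rank_inj).
by case: eqP.
Qed.

Definition packing_chromatic_number : nat := ex_minn ex_packing_colourable.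

End PackingColouring.

Section GeneralisedHGraph.
Variables l r : nat.

(* The vertex u^i_j is the pair (i, j); each edge is listed here in one
   direction, and [H_adj] is the symmetric closure. *)
Definition H_arc (x y : 'I_l.+2 * 'I_(2 * r)) : bool :=
  let: (i, j) := x in
  let: (i', j') := y in
  [|| [&& i' == i, (i == 0 :> nat) || (i == l.+1 :> nat)
        & j' == j.+1 %% (2 * r) :> nat],
      [&& i' == i, 1 <= i <= l, ~~ odd j & j' == j.+1 :> nat]
    | (i' == i.+1 :> nat) && (j' == j)].

Definition H_adj : rel ('I_l.+2 * 'I_(2 * r)) :=
  fun x y => H_arc x y || H_arc y x.

Lemma H_adj_sym : symmetric H_adj.
Proof. by move=> x y; rewrite /H_adj orbC. Qed.

Lemma H_adj_irrefl : irreflexive H_adj.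
Proof.
case=> i j; rewrite /H_adj orbb /= eqxx /=.
have /negPf-> : (j : nat) != j.+1 %% (2 * r).
  have [lt|ge] := ltnP j.+1 (2 * r); first by rewrite modn_small //; lia.
  have e : 2 * r = j.+1 by have := ltn_ord j; lia.
  have -> : j.+1 %% (2 * r) = 0 by rewrite [X in _ %% X]e modnn.
  lia.
have /negPf-> : (j : nat) != j.+1 by lia.
have /negPf-> : (i : nat) != i.+1 by lia.
by rewrite !andbF.
Qed.

Definition H_graph : sgraph := SGraph H_adj_sym H_adj_irrefl.

End GeneralisedHGraph.

(* Main.v *)
(* H^l(r) consists of r ladders (columns 2b and 2b+1, rows 0 to l+1) joined in a
   ring along their top and bottom rungs only.

   Lower bounds. Already in rows 0, 1, 2, two consecutive ladders admit no
   packing 4-colouring, so in a packing 5-colouring one of them contains the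
   colour 5 in these rows; and the two middle ladders of six consecutive ones
   cannot both contain it. Hence ladders with and without a 5 alternate around
   the ring, and r is even. Unrolling the ring makes both facts finite searches:
   a colouring becomes a function of (i, j) periodic in j.

   Upper bounds. In the unrolled graph two vertices in different ladders are at
   distance |j - j'| + min(i + i', 2(l+1) - i - i'). A colouring by {1, ..., 6} is
   therefore a cyclic sequence of words (the ladders) subject to conditions on
   seven consecutive rows of a word, and on the six extreme rows of ladders at
   most three apart. All these conditions bear on windows of bounded length, so
   they survive the repetition of a block of six rows, and of a block of ladders,
   once they hold for a few repetitions; one family of words for each residue
   of l modulo 6 then suffices, the case l = 3 being treated apart. *)

Require Import Defs.
From mathcomp Require Import all_boot.
From mathcomp Require Import zify.

Set Implicit Arguments.
Unset Strict Implicit.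
Unset Printing Implicit Defensive.

(** * Walks and distances *)

Section Walks.
Variable G : sgraph.
Implicit Types u v w : G.

Lemma walkP u v n :
  reflect (exists p, [/\ size p = n, path (@adj G) u p & last u p = v]) (walk u v n).
Proof.
apply: (iffP existsP) => [[p /andP[up /eqP <-]]|[p [sp up lp]]].
  by exists p; rewrite size_tuple.
have sp' : size p == n by rewrite sp.
by exists (Tuple sp'); rewrite /= up lp eqxx.
Qed.

Lemma walk_cat u v w m n : walk u v m -> walk v w n -> walk u w (m + n).
Proof.
move=> /walkP[p [<- up pv]] /walkP[q [<- vq qw]]; apply/walkP; exists (p ++ q).
by rewrite size_cat cat_path last_cat up pv.
Qed.

Lemma walk0 u : walk u u 0.
Proof. by apply/walkP; exists [::]. Qed.

Lemma walk1 u v : adj u v -> walk u v 1.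
Proof. by move=> uv; apply/walkP; exists [:: v]; rewrite /= uv. Qed.

Lemma walkS u v n :
  walk u v n.+1 -> exists2 w : G, walk u w n & adj w v.
Proof.
case/walkP; case/lastP=> [|p x] [] //; rewrite size_rcons => -[sp].
rewrite rcons_path last_rcons => /andP[up px] <-.
by exists (last u p) => //; apply/walkP; exists p.
Qed.

Lemma walk_sym u v n : walk u v n -> walk v u n.
Proof.
elim: n v => [|n IH] v; first by case/walkP=> p [/size0nil-> _ /= ->]; exact: walk0.
case/walkS=> w uw wv; rewrite -add1n; apply: walk_cat (IH _ uw).
by apply: walk1; rewrite adj_sym.
Qed.

Lemma dist_gtP u v n : reflect (forall m, m <= n -> ~~ walk u v m) (dist_gt u v n).
Proof.
rewrite /dist_gt /dist; case: {-}_ / idP => [uv|nuv].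
  case: ex_minnP => d wd dmin; apply: (iffP idP) => [nd m mn|nw].
    by apply: contraL nd => /dmin dm; rewrite -leqNgt (leq_trans dm).
  by rewrite ltnNge; apply/negP => /nw /negP.
apply: ReflectT => m _; apply/negP => /walkP[p [_ up pv]]; apply: nuv.
by apply/connectP; exists p.
Qed.

(** Walks replace distances: a lower bound exhibits one short walk, an upper bound excludes them
    all. *)
Lemma packing_colouringP k (f : {ffun G -> 'I_k}) :
  reflect (forall u v m, u != v -> f u = f v -> m <= (f u).+1 -> ~~ walk u v m)
          (packing_colouring f).
Proof.
apply: (iffP forallP) => [pf u v m uv fuv|pf u].
  by move/forallP: (pf u) => /(_ v); rewrite uv fuv eqxx => /dist_gtP; apply.
apply/forallP => v; apply/implyP => /andP[uv /eqP fuv].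
by apply/dist_gtP => m; apply: pf.
Qed.

End Walks.

(** * Lower bounds *)

Definition absdiff (x y : nat) := (x - y) + (y - x).

Lemma absdiffC x y : absdiff x y = absdiff y x.
Proof. exact: addnC. Qed.

Lemma absdiffE x y : x <= y -> absdiff x y = y - x.
Proof. by rewrite /absdiff -subn_eq0 => /eqP->. Qed.

Lemma absdiffDr x y z : absdiff (x + z) (y + z) = absdiff x y.
Proof. by rewrite /absdiff !subnDr. Qed.

Lemma absdiff_half x y : x./2 = y./2 -> absdiff x y = (odd x != odd y).
Proof.
rewrite -{2}(odd_double_half x) -{2}(odd_double_half y) => ->.
by rewrite absdiffDr; case: (odd x); case: (odd y).
Qed.

(* Distance of two cells (row, column) of the unrolled graph when only the top
   ring joins the ladders. *)
Definition comb_dist (p q : nat * nat) :=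
  (if p.2./2 == q.2./2 then absdiff p.1 q.1 else p.1 + q.1) + absdiff p.2 q.2.

(** The first branch is for cells coloured in advance: the search meets them again and must keep
    their colour. *)
Definition compatible (asg : seq ((nat * nat) * nat)) p c :=
  all (fun a => if a.1 == p then a.2 == c else (a.2 == c) ==> (c < comb_dist a.1 p)) asg.

(* [if] instead of [&&], both of whose arguments [vm_compute] would evaluate. *)
Fixpoint extendable k (asg : seq ((nat * nat) * nat)) cells :=
  if cells is p :: cells' then
    has (fun c => if compatible asg p c then extendable k ((p, c) :: asg) cells' else false)
        (iota 1 k)
  else true.

Definition ladder_cells b := [seq (i, x) | i <- iota 0 3, x <- iota b.*2 2].

Lemma mem_ladder_cells b p : (p \in ladder_cells b) = (p.1 < 3) && (p.2./2 == b).
Proof.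
case: p => i x; apply/allpairsP/idP => [[[i' x']]|].
  by rewrite !mem_iota => -[/= ? ? [-> ->]]; lia.
by move=> ib; exists (i, x); split=> //; rewrite mem_iota; move: ib => /=; lia.
Qed.

Definition ladders s := flatten [seq ladder_cells b | b <- s].

Lemma mem_ladders s p : (p \in ladders s) = (p.1 < 3) && (p.2./2 \in s).
Proof.
apply/flatten_mapP/andP => [[b bs]|[p3 ps]]; last first.
  by exists p.2./2; rewrite // mem_ladder_cells p3 eqxx.
by rewrite mem_ladder_cells => /andP[-> /eqP->].
Qed.

(** The colours of [g] form a branch of the search that is never pruned. *)
Lemma extendable_sound k (g : nat * nat -> nat) asg cells (W : pred (nat * nat)) :
  (forall p, W p -> 0 < g p <= k) ->
  (forall p q, W p -> W q -> p != q -> g p = g q -> g p < comb_dist p q) ->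
  all (fun a => W a.1 && (a.2 == g a.1)) asg -> all W cells ->
  extendable k asg cells.
Proof.
move=> gk gW; elim: cells asg => //= p cells IH asg asgW /andP[Wp Wc].
apply/hasP; exists (g p); first by rewrite mem_iota; have := gk _ Wp; lia.
suff -> : compatible asg p (g p) by apply: IH => //=; rewrite Wp eqxx.
apply/allP => -[q c] /(allP asgW) /= /andP[Wq /eqP->].
case: eqP => [->//|/eqP qp]; apply/implyP => /eqP gqp; rewrite -gqp.
exact: gW.
Qed.

Lemma two_ladders_not_4_colourable :
  extendable 4 [::] (ladders [:: 0; 1]) = false.
Proof. by vm_compute. Qed.

(* The cells are visited outwards from the two given 5s, to fail early. *)
Lemma middle_ladders_not_both_5 :
  has (fun p => has (fun q => extendable 5 [:: (p, 5); (q, 5)] (ladders [:: 2; 3; 1; 4; 0; 5]))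
    (ladder_cells 3)) (ladder_cells 2) = false.
Proof. by vm_compute. Qed.

(** * Lifting a colouring to the unrolled graph *)

Section LowerBound.
Variables (l r : nat).
Hypothesis r_gt0 : 0 < r.

Let ring_gt0 : 0 < 2 * r. Proof. by lia. Qed.

Definition vtx i j : H_graph l r := (inord i, Ordinal (ltn_pmod j ring_gt0)).

Lemma vtx_down i j : i <= l -> adj (vtx i j) (vtx i.+1 j).
Proof.
move=> il; rewrite /= /H_adj /H_arc /= !inordK; try lia.
by rewrite !eqxx !orbT.
Qed.

Lemma vtx_ring j : adj (vtx 0 j) (vtx 0 j.+1).
Proof.
rewrite /= /H_adj /H_arc /= !inordK // !eqxx /=.
by rewrite -(addn1 (j %% _)) modnDml addn1 eqxx.
Qed.

Lemma vtx_rung i j : i <= l.+1 -> ~~ odd j -> adj (vtx i j) (vtx i j.+1).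
Proof.
move=> il jev; have [->|i0] := posnP i; first exact: vtx_ring.
have jr : ~~ odd (j %% (2 * r)).
  by move: jev; rewrite {1}(divn_eq j (2 * r)) oddD !oddM andbF.
have jS : j.+1 %% (2 * r) = (j %% (2 * r)).+1.
  have := ltn_pmod j ring_gt0.
  by rewrite -(addn1 j) -modnDml addn1 => lt; rewrite modn_small //; lia.
rewrite /= /H_adj; apply/orP; left; apply/or3P; rewrite /= !inordK //.
have [->|il1] := eqVneq i l.+1.
  by constructor 1; rewrite !eqxx orbT -(addn1 (j %% _)) modnDml addn1 eqxx.
by constructor 2; rewrite eqxx jr jS eqxx; lia.
Qed.

Lemma walk_down i i' j : i <= i' <= l.+1 -> walk (vtx i j) (vtx i' j) (i' - i).
Proof.
elim: i' => [|i' IH]; first by case: i => //= _; apply: walk0.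
rewrite leq_eqVlt => /andP[/predU1P[->|ii'] i'l]; first by rewrite subnn walk0.
rewrite subSn // -(addn1 (i' - i)); apply: walk_cat (IH _) _; first lia.
by apply: walk1; apply: vtx_down.
Qed.

Lemma walk_vert i i' j : i <= l.+1 -> i' <= l.+1 ->
  walk (vtx i j) (vtx i' j) (absdiff i i').
Proof.
move=> il i'l; case: (leqP i i') => ii'.
  have -> : absdiff i i' = i' - i by rewrite /absdiff; lia.
  by apply: walk_down; lia.
have -> : absdiff i i' = i - i' by rewrite /absdiff; lia.
by apply: walk_sym; apply: walk_down; lia.
Qed.

Lemma walk_ring j d : walk (vtx 0 j) (vtx 0 (j + d)) d.
Proof.
elim: d => [|d IH]; first by rewrite addn0 walk0.
by rewrite addnS -[X in walk _ _ X]addn1; apply: walk_cat IH (walk1 (vtx_ring _)).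
Qed.

(** Between different ladders, the walk goes up to row 0, along the ring and down again. Distances
    are thus bounded from above, as a refutation requires. *)
Lemma walk_comb_dist p q : p.1 <= l.+1 -> q.1 <= l.+1 ->
  walk (vtx p.1 p.2) (vtx q.1 q.2) (comb_dist p q).
Proof.
wlog pq : p q / p.2 <= q.2 => [IH pl ql|].
  have [/IH|/ltnW qp] := leqP p.2 q.2; first exact.
  have -> : comb_dist p q = comb_dist q p.
    by rewrite /comb_dist /absdiff eq_sym; case: ifP => _; lia.
  by apply: walk_sym; apply: IH.
case: p q pq => [i j] [i' j'] /= jj' il i'l.
rewrite /comb_dist /=; case: eqP => hjj'.
  apply: walk_cat (walk_vert _ il i'l) _.
  have [->|j'E] : j' = j \/ (j' = j.+1 /\ ~~ odd j) by lia.
    by rewrite /absdiff subnn walk0.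
  case: j'E => -> jev; have -> : absdiff j j.+1 = 1 by rewrite /absdiff; lia.
  by apply: walk1; apply: vtx_rung.
have -> : i + i' + absdiff j j' = (absdiff i 0 + (j' - j)) + absdiff 0 i'.
  by rewrite /absdiff; lia.
apply: walk_cat (walk_vert _ _ i'l) => //.
apply: walk_cat (walk_vert _ il _) _ => //.
by rewrite -{1}(subnKC jj'); apply: walk_ring.
Qed.

Lemma vtx_inj i i' j j' : i <= l.+1 -> i' <= l.+1 -> absdiff j j' < 2 * r ->
  vtx i j = vtx i' j' -> (i, j) = (i', j').
Proof.
move=> il i'l jj' [] /(congr1 val); rewrite /= !inordK // => -> /eqP.
rewrite /absdiff in jj'; case: (leqP j j') => [jle|/ltnW jle].
  rewrite eq_sym eqn_mod_dvd // => /dvdnP[[|q]]; last by lia.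
  by move=> qE; congr (_, _); lia.
rewrite eqn_mod_dvd // => /dvdnP[[|q]]; last by lia.
by move=> qE; congr (_, _); lia.
Qed.

Variables (k : nat) (f : {ffun H_graph l r -> 'I_k}).
Hypothesis f_packing : packing_colouring f.

Definition lift_colour (p : nat * nat) := (f (vtx p.1 p.2)).+1.

Lemma lift_colour_comb p q : p.1 <= l.+1 -> q.1 <= l.+1 ->
  absdiff p.2 q.2 < 2 * r -> p != q -> lift_colour p = lift_colour q ->
  lift_colour p < comb_dist p q.
Proof.
move=> pl ql pq npq [/val_inj fpq]; rewrite ltnNge; apply/negP => le.
have /packing_colouringP/(_ _ _ _ _ fpq le)/negP := f_packing.
apply; last exact: walk_comb_dist.
by apply: contra_neq npq => /(vtx_inj pl ql pq); rewrite -!surjective_pairing.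
Qed.

Lemma lift_colour_periodic i j : lift_colour (i, j + 2 * r) = lift_colour (i, j).
Proof.
rewrite /lift_colour /=; congr (f _).+1; congr (_, _).
by apply: val_inj; rewrite /= modnDr.
Qed.

(* The last hypothesis prevents two conflicting cells from being the same vertex. *)
Lemma lift_colour_search m asg cells b : 2 <= l ->
  all (fun c => lift_colour c < m.+1) [seq (c.1, c.2 + b.*2) | c <- cells] ->
  all (fun c => c.1 < 3) cells -> all (fun a => a.1 \in cells) asg ->
  all (fun a => lift_colour (a.1.1, a.1.2 + b.*2) == a.2) asg ->
  (forall p q, p \in cells -> q \in cells -> m < 2 * r \/ absdiff p.2 q.2 < 2 * r) ->
  extendable m asg cells.
Proof.
move=> l2 lm rows asgc asgE dr.
pose g (p : nat * nat) := lift_colour (p.1, p.2 + b.*2).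
apply: (@extendable_sound m g _ _ (mem cells)).
- by move=> p pc; rewrite ltnS; move/allP: lm; apply; apply: map_f.
- move=> p q pc qc npq gpq.
  have p3 := allP rows _ pc; have q3 := allP rows _ qc.
  have dE : comb_dist (p.1, p.2 + b.*2) (q.1, q.2 + b.*2) = comb_dist p q.
    have hE x : (x + b.*2)./2 = x./2 + b by rewrite halfD odd_double andbF doubleK.
    by rewrite /comb_dist /= !hE eqn_add2r !absdiffDr.
  have gm : g p <= m by move/allP: lm => lm; rewrite -ltnS; apply: lm; apply: map_f.
  (* At a full turn or more, [comb_dist] is at least [2 * r], and [dr] keeps the colours below
     that. *)
  rewrite -dE; case: (leqP (2 * r) (absdiff p.2 q.2)) => far.
    have [mr|] := dr p q pc qc; last by rewrite ltnNge far.
    rewrite dE (leq_ltn_trans gm) // (leq_trans mr) // (leq_trans far) //.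
    exact: leq_addl.
  have row_le i : i < 3 -> i <= l.+1 by move=> i3; rewrite ltnW // (leq_trans i3).
  apply: lift_colour_comb; rewrite ?row_le //= ?absdiffDr //.
  apply: contra_neq npq => -[e1 /addIn e2]; move: e1 e2.
  by case: p q {p3 q3 pc qc gpq dE gm far} => ? ? [? ?] /= -> ->.
- by apply/allP => a aa; rewrite eq_sym (allP asgE _ aa) andbT; apply: (allP asgc).
by apply/allP.
Qed.

End LowerBound.

Lemma even_of_alternating (h : nat -> bool) r :
  (forall a, h (a + r) = h a) -> (forall a, h a.+1 = ~~ h a) -> ~~ odd r.
Proof.
move=> hr hS; have : h r = h 0 (+) odd r.
  by elim: r {hr} => [|r IH]; rewrite ?addbF // hS IH /= addbN.
by rewrite -[r]add0n hr; case: (h 0); case: (odd _).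
Qed.

Lemma not_4_colourable l r k : 2 <= l -> 2 <= r -> k <= 4 ->
  ~~ packing_colourable (H_graph l r) k.
Proof.
move=> l2 r2 k4; apply/existsP => -[f fp].
have r0 : 0 < r by lia.
have := two_ladders_not_4_colourable.
rewrite (@lift_colour_search l r r0 k f fp 4 [::] _ 0) //.
- by apply/allP => p _; apply: leq_ltn_trans (ltn_ord _) _.
(* Four columns do not wrap around, as [2 * r >= 4]. *)
- by move=> p q; rewrite !mem_ladders !inE /absdiff; right; lia.
Qed.

Lemma not_5_colourable l r k : 2 <= l -> 2 <= r -> odd r -> k <= 5 ->
  ~~ packing_colourable (H_graph l r) k.
Proof.
move=> l2 r2 rodd k5; apply/existsP => -[f fp].
have r0 : 0 < r by lia.
pose F := lift_colour r0 f.
have F5 p : F p <= 5 by apply: leq_trans (ltn_ord _) k5.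
(* [h a] concerns ladder [a + 2], so that [a + 2] and [a + 3] are the middle ones of the ladders [a]
   to [a + 5]. *)
pose h a := has (fun p => F (p.1, p.2 + a.*2) == 5) (ladder_cells 2).
suff : ~~ odd r by rewrite rodd.
apply: (@even_of_alternating h) => a.
  apply: eq_has => p; have -> : p.2 + (a + r).*2 = p.2 + a.*2 + 2 * r by lia.
  by rewrite /F lift_colour_periodic.
have [/hasP[p p2 /eqP Fp]|nh] := boolP (h a); last first.
  apply: contraFT two_ladders_not_4_colourable => nhS.
  apply: (@lift_colour_search l r r0 k f fp 4 _ _ a.+2) => //.
  - apply/allP => _ /mapP[[i x] pc ->]; rewrite ltnS -ltnS ltn_neqAle F5 andbT.
    move: pc; rewrite mem_ladders !inE /= => /andP[i3 /orP[] xb].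
      apply: contra nh => Fp; apply/hasP; exists (i, x + 4).
        by rewrite mem_ladder_cells /=; lia.
      by have <- : x + a.+2.*2 = x + 4 + a.*2 by lia.
    apply: contra nhS => Fp; apply/hasP; exists (i, x + 2).
      by rewrite mem_ladder_cells /=; lia.
    by have <- : x + a.+2.*2 = x + 2 + a.+1.*2 by lia.
  - by move=> p q; rewrite !mem_ladders !inE /absdiff; right; lia.
apply/negbTE; apply: contraFN middle_ladders_not_both_5 => /hasP[q q2 /eqP Fq].
apply/hasP; exists p => //; apply/hasP; exists (q.1, q.2 + 2).
  by move: q2; rewrite !mem_ladder_cells /=; lia.
move: p2 q2; rewrite !mem_ladder_cells => p2 q2.
apply: (@lift_colour_search l r r0 k f fp 5 _ _ a) => //.
- by apply/allP => _ /mapP[c _ ->]; apply: F5.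
- rewrite [all _ _]andbA andbT !mem_ladders !inE.
  by case: p q p2 q2 {Fp Fq} => [i x] [i' x'] /=; lia.
- rewrite /= -/F Fp eqxx /=; have -> : q.2 + 2 + a.*2 = q.2 + a.+1.*2 by lia.
  by rewrite -/F Fq.
(* An odd [r >= 2] is at least 3, so [5 < 2 * r], although the six ladders may overlap around the
   ring. *)
- by left; lia.
Qed.

(** * Upper bounds *)

Lemma take_cat_take (T : Type) w (s t : seq T) : take w (s ++ take w t) = take w (s ++ t).
Proof. by rewrite !take_cat take_takel ?leq_subr. Qed.

Lemma take_pump (T : Type) w (P v : seq T) j n : w <= j * size P -> j <= n ->
  take w (flatten (nseq n P) ++ v) = take w (flatten (nseq j P)).
Proof.
move=> wj jn; have szP i : size (flatten (nseq i P)) = i * size P.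
  by rewrite size_flatten /shape map_nseq sumn_nseq mulnC.
by rewrite -(subnKC jn) nseqD flatten_cat -catA takel_cat // szP.
Qed.

Section Windows.
Variables (T : Type) (w : nat) (R : T -> seq T -> bool).

Fixpoint windows s := if s is x :: s' then R x s' && windows s' else true.

Lemma windows_nth x0 s i : windows s -> i < size s -> R (nth x0 s i) (drop i.+1 s).
Proof. by elim: s i => [|x s IH] [|i] //= /andP[Rx /IH]; rewrite ?drop0 //; apply. Qed.

Lemma windows_catr s t : windows (s ++ t) -> windows t.
Proof. by elim: s => //= x s IH /andP[_ /IH]. Qed.

Hypothesis R_local : forall x s, R x (take w s) = R x s.

(** Entries of [s] see at most the first [w] entries of what follows [s]. *)
Lemma windows_cat_take s t t' : take w t = take w t' -> windows t -> windows t' ->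
  windows (s ++ t) = windows (s ++ t').
Proof.
move=> tt' Wt Wt'; elim: s => [|x s IH] /=; first by rewrite Wt Wt'.
by rewrite IH -[R x (s ++ t)]R_local -take_cat_take tt' take_cat_take R_local.
Qed.

(** From [j] copies of [P] on, the first [w] entries no longer change, so one more copy in front
    poses no new condition. *)
Lemma windows_pump j k u P v : w <= j * size P -> j < k ->
  windows (u ++ flatten (nseq j.+1 P) ++ v) -> windows (u ++ flatten (nseq k P) ++ v).
Proof.
move=> wj jk Wu; pose t n := flatten (nseq n P) ++ v.
have tS n : t n.+1 = P ++ t n by rewrite /t /= catA.
have tE n : j <= n -> take w (t n) = take w (t j).
  by move=> jn; rewrite !(take_pump _ wj).
have Wt n : windows (t (j + n)) && windows (t (j + n).+1).
  elim: n => [|n /andP[Wn WSn]].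
    by have Wj1 := windows_catr Wu; rewrite addn0 Wj1 andbT; apply: (@windows_catr P); rewrite -tS.
  rewrite addnS WSn tS (@windows_cat_take P _ (t (j + n))) -?tS ?WSn //.
  by rewrite !tE //; lia.
have [n ->] : exists n, k = (j + n).+1 by exists (k - j.+1); lia.
have /andP[_ W0] := Wt 0; have /andP[_ Wn] := Wt n.
rewrite -[_ ++ v]/(t (j + n).+1) (@windows_cat_take u _ (t j.+1)) //; last by rewrite -[j]addn0.
by rewrite !tE //; lia.
Qed.

End Windows.

Lemma all_zip_iota (T : Type) (P : nat * T -> bool) x0 m n s h :
  all P (zip (iota m n) s) -> h < n -> h < size s -> P (m + h, nth x0 s h).
Proof.
elim: s m n h => [|x s IH] m [|n] [|h] //= /andP[Px Ps]; first by rewrite addn0.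
by rewrite !ltnS addnS -addSn => hn hs; apply: (IH _ n).
Qed.

Lemma zip_iota_take (T : Type) m n (s : seq T) : zip (iota m n) (take n s) = zip (iota m n) s.
Proof. by elim: s m n => [|x s IH] m [|n] //=; rewrite IH. Qed.

(** * Ladders as words *)

(* A word lists the pairs of colours on the successive rungs of a ladder. *)
Definition word := seq (nat * nat).

Definition far (c d e : nat) := (c == d) ==> (c < e).

Definition rows_far (p q : nat * nat) h :=
  [&& far p.1 q.1 h, far p.2 q.2 h, far p.1 q.2 h.+1 & far p.2 q.1 h.+1].

(** Six rows ahead suffice, since colours will not exceed 6. *)
Definition row_ok (p : nat * nat) (s : word) :=
  (p.1 != p.2) && all (fun hq => rows_far p hq.2 hq.1) (zip (iota 1 6) s).

Definition word_ok k n (W : word) :=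
  [&& size W == n, windows row_ok W & all (fun p => (0 < p.1 <= k) && (0 < p.2 <= k)) W].

(* [e] is the distance between equal columns; [same] flags rows that belong to
   the same rung of the graph, met again after a full turn. *)
Definition rows_linked (same : bool) (p q : nat * nat) e :=
  [&& same || (far p.1 q.1 e && far p.2 q.2 e), far p.1 q.2 e.+1 & far p.2 q.1 e.-1].

(** Six rows suffice: for positive [d], a path through this end from a deeper row has length at
    least 7. *)
Definition ends_linked ex d (V W : word) :=
  all (fun ip => all (fun jq =>
    rows_linked (ex && (ip.1 == jq.1)) ip.2 jq.2 (d.*2 + ip.1 + jq.1))
    (zip (iota 0 6) W)) (zip (iota 0 6) V).

(* Both ends of a ladder, read inwards. *)
Definition ends (W : word) := (take 6 W, take 6 (rev W)).

Definition linked ex d (X Y : word * word) := ends_linked ex d X.1 Y.1 && ends_linked ex d X.2 Y.2.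

(** Ladders four or more apart are at least 7 columns apart, out of reach of colour 6. *)
Definition link_ok ex X s :=
  all (fun dY => linked (ex && (dY.1 == 3)) dY.1 X dY.2) (zip (iota 1 3) s).

(* [ex] is set for three ladders, when the third ladder to the right is the same one. *)
Definition cycle_ok ex (s : seq (word * word)) :=
  windows (link_ok ex) (s ++ take 3 (s ++ s)).

Definition cell (W : word) i (b : bool) :=
  if b then (nth (0, 0) W i).2 else (nth (0, 0) W i).1.

Lemma cell_range k n W i b : word_ok k n W -> i < n -> 0 < cell W i b <= k.
Proof.
case/and3P=> /eqP <- _ /all_nthP Wk /(Wk (0, 0)) /andP[].
by rewrite /cell; case: b.
Qed.

Lemma cell_rung k n W i : word_ok k n W -> i < n -> cell W i false != cell W i true.
Proof. by case/and3P=> /eqP <- WW _ /(windows_nth (0, 0) WW) /andP[]. Qed.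

Lemma cell_far k n W i i' b b' : word_ok k n W -> k <= 6 -> i < i' < n ->
  cell W i b = cell W i' b' -> cell W i b < i' - i + (b != b').
Proof.
move=> Wok k6 /andP[ii' i'n] bb'; case: (leqP (i' - i) 6) => [i6|]; last first.
  by have := @cell_range _ _ _ i b Wok (ltn_trans ii' i'n); lia.
case/and3P: (Wok) => /eqP szW WW _.
have iW : i < size W by rewrite szW (ltn_trans ii').
have /andP[_ Wi] := windows_nth (0, 0) WW iW.
have := all_zip_iota (0, 0) (h := (i' - i).-1) Wi; rewrite size_drop nth_drop szW.
move=> /(_ ltac:(lia) ltac:(lia)).
have -> : i.+1 + (i' - i).-1 = i' by lia.
have -> : 1 + (i' - i).-1 = i' - i by lia.
move=> /and4P[]; rewrite /far; move: bb'; rewrite /cell.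
by case: b; case: b' => -> /=; rewrite !eqxx /= ?addn0 ?addn1 => *.
Qed.

(** The columns differ by [d.*2 + b' - b]; moving [b] to the left avoids truncated subtraction. The
    first alternative is the return to the same vertex after a full turn. *)
Lemma cell_linked ex d V W i i' b b' : 0 < d -> ends_linked ex d (take 6 V) (take 6 W) ->
  i < size V -> i' < size W -> cell V i b <= 6 -> cell V i b = cell W i' b' ->
  [&& ex, i == i' & b == b'] \/ cell V i b + b < d.*2 + i + i' + b'.
Proof.
move=> d0 VW iV i'W c6 cc.
have [i6|] := ltnP i 6; last by right; lia.
have [i'6|] := ltnP i' 6; last by right; lia.
move: VW; rewrite /ends_linked !zip_iota_take => VW.
have := all_zip_iota (0, 0) VW i6; rewrite add0n => /(_ iV) Wi; have := all_zip_iota (0, 0) Wi i'6.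
rewrite add0n => /(_ i'W) /= /and3P[]; rewrite /far; move: cc c6; rewrite /cell.
by case: b; case: b' => -> /=; rewrite !eqxx /= ?andbT => ck; case: (ex && (i == i')) => /=;
  try (by left); right; lia.
Qed.

(** * Distances in the unrolled graph *)

Definition cov_dist l (p q : nat * nat) :=
  (if p.2./2 == q.2./2 then absdiff p.1 q.1 else minn (p.1 + q.1) (2 * l.+1 - p.1 - q.1))
  + absdiff p.2 q.2.

Definition cov_adj l (p q : nat * nat) :=
  (p.1 = q.1 /\ absdiff p.2 q.2 = 1 /\ (p.1 = 0 \/ p.1 = l.+1 \/ p.2./2 = q.2./2)) \/
  (p.2 = q.2 /\ absdiff p.1 q.1 = 1).

(** Growing by at most 1 along each edge, [cov_dist] is a lower bound for the length of walks. *)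
Lemma cov_dist_adj l p q q' : p.1 <= l.+1 -> q.1 <= l.+1 -> q'.1 <= l.+1 ->
  cov_adj l q q' -> cov_dist l p q' <= (cov_dist l p q).+1.
Proof.
case: p q q' => [i j] [i1 j1] [i2 j2]; rewrite /cov_adj /cov_dist /=.
move=> il i1l i2l [[-> [j12 i2E]]|[-> i12]]; last first.
  by rewrite -addSn leq_add2r; case: ifP => _; move: i12; rewrite /absdiff; clear -il i1l i2l; lia.
(* Edges between ladders lie in the two end rows, where both formulas of [cov_dist] agree. *)
have i2_end : i2 = 0 \/ i2 = l.+1 ->
    minn (i + i2) (2 * l.+1 - i - i2) = absdiff i i2 by rewrite /absdiff; clear -il; lia.
rewrite -addnS; apply: leq_add; last by move: j12; rewrite /absdiff; clear; lia.
have [<-//|j12h] := eqVneq j1./2 j2./2.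
rewrite !i2_end ?if_same //; case: i2E => [|[]]; auto.
all: by move=> e; rewrite e eqxx in j12h.
Qed.

Lemma cov_distC l p q : cov_dist l p q = cov_dist l q p.
Proof. by rewrite /cov_dist /absdiff eq_sym; case: ifP => _; lia. Qed.

Section UpperBound.
Variables (l r : nat).
Hypothesis r_ge2 : 1 < r.

(** Walks lift to the unrolled graph; [m <= j] keeps the lift from running below column 0. *)
Lemma walk_cov (u v : H_graph l r) m j : walk u v m -> m <= j -> u.2 = j %% (2 * r) :> nat ->
  exists2 j', v.2 = j' %% (2 * r) :> nat & cov_dist l (u.1 : nat, j) (v.1 : nat, j') <= m.
Proof.
move=> + + uj; elim: m v => [|m IH] v.
  case/walkP=> p [/size0nil-> _ /= <-] _; exists j => //.
  by rewrite /cov_dist /absdiff /= eqxx; lia.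
case/walkS=> w /IH{}IH wv mj; have [|j' wj' dw] := IH; first lia.
have j'_gt0 : 0 < j' by move: dw; rewrite /cov_dist /absdiff /=; lia.
suff [j2 vj2 a] : exists2 j2, v.2 = j2 %% (2 * r) :> nat
    & cov_adj l (w.1 : nat, j') (v.1 : nat, j2).
  exists j2 => //; by apply: leq_trans (cov_dist_adj _ _ _ a) _; rewrite //= -ltnS.
move: wv wj'; case: w {IH dw} => [i1 x1]; case: v => [i2 x2] /=.
have oddm x : odd (x %% (2 * r)) = odd x by rewrite {2}(divn_eq x (2 * r)) oddD !oddM andbF.
have r2 : 0 < 2 * r by lia.
rewrite /H_adj /H_arc => /orP[] /or3P[].
- case/and3P=> /eqP-> i1E /eqP x2E x1E; exists j'.+1.
    by rewrite x2E x1E -addn1 modnDml addn1.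
  by left; rewrite /absdiff /=; lia.
- case/and4P=> /eqP-> i1E x1ev /eqP x2E x1E; exists j'.+1.
    by rewrite -[j'.+1]addn1 -modnDml -x1E addn1 -x2E modn_small.
  by move: x1ev; rewrite x1E oddm; left; rewrite /absdiff /=; lia.
- case/andP=> /eqP i2E /eqP-> x1E; exists j' => //.
  by right; rewrite /absdiff /=; lia.
- case/and3P=> /eqP-> i1E /eqP x1E' x1E; exists j'.-1.
    move/eqP: x1E; rewrite x1E' -{1}(prednK j'_gt0) -addn1 -[j'.-1.+1]addn1 eqn_modDr.
    by move/eqP <-; rewrite modn_small.
  by left; rewrite /absdiff /=; lia.
- case/and4P=> /eqP-> i1E x2ev /eqP x1E' x1E; exists j'.-1.
    have : x2.+1 = j'.-1.+1 %[mod 2 * r] by rewrite prednK // -x1E -x1E' modn_small.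
    by move/eqP; rewrite -addn1 -[j'.-1.+1]addn1 eqn_modDr => /eqP <-; rewrite modn_small.
  by move: (oddm j'); rewrite -x1E x1E' /=; left; rewrite /absdiff /=; lia.
case/andP=> /eqP i2E /eqP-> x1E; exists j' => //.
by right; rewrite /absdiff /=; lia.
Qed.

Variables (k : nat) (L : nat -> word).
Hypothesis k_le6 : k < 6.
Hypothesis L_periodic : forall a, L (a + r) = L a.
Hypothesis L_ok : forall a, word_ok k.+1 l.+2 (L a).
Hypothesis L_linked : forall a d, 0 < d <= 3 ->
  linked ((r == 3) && (d == 3)) d (ends (L a)) (ends (L (a + d))).

Definition cov_colour (p : nat * nat) := cell (L p.2./2) p.1 (odd p.2).

(** Within a ladder [cell_far] decides, and four ladders apart the columns do. Otherwise a path uses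
    one of the two ends, and the links exclude both, unless three ladders close up to the same
    vertex. *)
Lemma cov_colour_far p q : p.1 < l.+2 -> q.1 < l.+2 -> cov_colour p = cov_colour q ->
  cov_dist l p q <= cov_colour p -> p.1 = q.1 /\ p.2 = q.2 %[mod 2 * r].
Proof.
wlog pq : p q / p.2 <= q.2 => [IH pl ql cpq dpq|].
  have [/IH|/ltnW qp] := leqP p.2 q.2; first exact.
  by have := IH q p qp ql pl (esym cpq); rewrite -cpq cov_distC => /(_ dpq) [-> ->].
case: p q pq => [i j] [i' j'] /= jj' il i'l; rewrite /cov_colour /= => cc.
have c6 : cell (L j./2) i (odd j) <= 6.
  by have /andP[_] := cell_range (odd j) (L_ok j./2) il; lia.
rewrite /cov_dist /=; case: eqP => hjj'.
  rewrite (absdiff_half hjj'); rewrite -hjj' in cc; have [ii'|ii'|ii'] := ltngtP i i'.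
  - by rewrite (absdiffE (ltnW ii')) leqNgt (cell_far (L_ok _) k_le6 _ cc) ?ii'.
  - rewrite absdiffC (absdiffE (ltnW ii')) cc eq_sym leqNgt.
    by rewrite (cell_far (L_ok _) k_le6 _ (esym cc)) ?ii'.
  have [->//|jj] := eqVneq j j'; have := cell_rung (L_ok j./2) il.
  move: cc; rewrite -ii'; have [-> ->] : odd j = false /\ odd j' = true.
    by clear -jj' jj hjj'; lia.
  by move=> -> /eqP.
have d0 : 0 < j'./2 - j./2 by clear -jj' hjj'; lia.
have [d3|d4] := leqP (j'./2 - j./2) 3; last first.
  have d7 : 6 < absdiff j j' by rewrite absdiffE //; clear -d4; lia.
  by move/(leq_trans (leq_addl _ _))/leq_trans/(_ c6); rewrite leqNgt d7.
have := L_linked j./2 (introT andP (conj d0 d3)).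
rewrite subnKC ?half_leq //; case/andP=> /= top bot.
have szL a : size (L a) = l.+2 by case/and3P: (L_ok a) => /eqP.
(* A reversed word numbers the rows from the bottom. *)
have revE a x b : x < l.+2 -> cell (rev (L a)) (l.+1 - x) b = cell (L a) x b.
  move=> xl; rewrite /cell nth_rev szL; last by clear; lia.
  by have -> : l.+2 - (l.+1 - x).+1 = x by clear -xl; lia.
have := @cell_linked _ _ _ _ i i' (odd j) (odd j') d0 top; rewrite !szL => /(_ il i'l c6 cc).
have := @cell_linked _ _ _ _ (l.+1 - i) (l.+1 - i') (odd j) (odd j') d0 bot.
rewrite !size_rev !szL !revE // !ltnS !leq_subr => /(_ isT isT c6 cc).
have same : r = 3 -> j'./2 - j./2 = 3 -> odd j = odd j' -> j = j' %[mod 2 * r].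
  move=> r3 d3' oo; have -> : j' = j + 2 * r by clear -r3 d3' oo d0; lia.
  by rewrite modnDr.
case=> [/and3P[/andP[/eqP r3 /eqP d3'] /eqP ii' /eqP oo] _ _|bot_far].
  by split; [clear -il i'l ii'; lia | apply: same].
case=> [/and3P[/andP[/eqP r3 /eqP d3'] /eqP ii' /eqP oo] _|top_far dle].
  by split; last apply: same.
rewrite (absdiffE jj') in dle; exfalso.
move: (odd_double_half j) (odd_double_half j') dle top_far bot_far d0.
clear -il i'l; move: (odd j) (odd j') j./2 j'./2 (cell _ _ _) => b b' a a' c <- <-; lia.
Qed.

Lemma words_colourable : packing_colourable (H_graph l r) k.+1.
Proof.
have col_range (u : H_graph l r) : 0 < cov_colour (u.1 : nat, u.2 : nat) <= k.+1.
  exact: cell_range (L_ok _) (ltn_ord _).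
pose f := [ffun u : H_graph l r => inord (cov_colour (u.1 : nat, u.2 : nat)).-1 : 'I_k.+1].
have fE u : (f u).+1 = cov_colour (u.1 : nat, u.2 : nat).
  by rewrite ffunE inordK; have := col_range u; lia.
have colD i j n : cov_colour (i, j + n * (2 * r)) = cov_colour (i, j).
  elim: n => [|n IH]; first by rewrite addn0.
  rewrite -IH mulSn addnCA addnC /cov_colour /=; set x := j + _.
  have -> : (x + 2 * r)./2 = x./2 + r by lia.
  by rewrite L_periodic; congr cell; lia.
have colM i j : cov_colour (i, j %% (2 * r)) = cov_colour (i, j).
  by rewrite {2}(divn_eq j (2 * r)) addnC colD.
apply/existsP; exists f; apply/packing_colouringP => u v m uv fuv m_le.
(* Three full turns are at least 12 columns, more than any colour, so the lift has room on the
   left. *)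
apply: contra_neqN uv => /(walk_cov (j := u.2 + 3 * (2 * r))).
rewrite fE in m_le; case; first by have := col_range u; lia.
  by rewrite addnC modnMDl modn_small.
move=> j' vj' duv.
have := @cov_colour_far (u.1 : nat, u.2 + 3 * (2 * r)) (v.1 : nat, j').
rewrite colD -[RHS in _ = RHS -> _]colM -vj' -!fE fuv => /(_ (ltn_ord _) (ltn_ord _) erefl).
rewrite -fuv fE => /(_ (leq_trans duv m_le)) /= [e1 e2].
move: e2; rewrite addnC modnMDl modn_small // => e2.
by case: u v e1 e2 {fuv m_le vj' duv} => [i x] [i' x'] /= /val_inj-> /val_inj->.
Qed.


End UpperBound.

(** * Cyclic sequences of ladders *)

Lemma link_ok_local ex X s : link_ok ex X (take 3 s) = link_ok ex X s.
Proof. by rewrite /link_ok zip_iota_take. Qed.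

Lemma row_ok_local p s : row_ok p (take 6 s) = row_ok p s.
Proof. by rewrite /row_ok zip_iota_take. Qed.

(** The doubling of [s] serves length 2, where three ladders make more than one turn. *)
Lemma nth_cat_take_cycle (T : Type) (x0 : T) (s : seq T) a d : 1 < size s -> a < size s -> d <= 3 ->
  nth x0 (s ++ take 3 (s ++ s)) (a + d) = nth x0 s ((a + d) %% size s).
Proof.
move=> s2 sa d3; rewrite nth_cat; case: ltnP => ads; first by rewrite modn_small.
rewrite nth_take; last by lia.
have -> : (a + d) %% size s = (a + d - size s) %% size s by rewrite -{1}(subnK ads) modnDr.
rewrite nth_cat; case: ltnP => ads2; first by rewrite modn_small.
by rewrite -[in RHS](subnK ads2) modnDr modn_small //; lia.
Qed.

Lemma cycle_colourable k l (s : seq word) : k < 6 -> 1 < size s ->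
  all (word_ok k.+1 l.+2) s -> cycle_ok (size s == 3) (map ends s) ->
  packing_colourable (H_graph l (size s)) k.+1.
Proof.
move=> k6 s2 /all_nthP sok scyc; have s0 : 0 < size s by apply: ltnW.
apply: (words_colourable s2 (L := fun a => nth [::] s (a %% size s))) => //.
- by move=> a; rewrite modnDr.
- by move=> a; apply: sok; rewrite ltn_mod.
move=> a d /andP[d0 d3]; rewrite -modnDml; move: (a %% _) (ltn_pmod a s0) => {}a as_.
rewrite -(nth_map [::] (ends [::])) // -(nth_map [::] (ends [::])) ?ltn_mod //.
have szE : size (map ends s) = size s by rewrite size_map.
have sa : a < size (map ends s ++ take 3 (map ends s ++ map ends s)).
  by rewrite size_cat szE; lia.
have := windows_nth (ends [::]) scyc sa; rewrite nth_cat szE as_ => W.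
have := all_zip_iota (ends [::]) (h := d.-1) W.
have -> : 1 + d.-1 = d by lia.
rewrite nth_drop; have -> : a.+1 + d.-1 = a + d by lia.
rewrite -szE nth_cat_take_cycle ?szE //.
by apply; rewrite ?size_drop ?size_cat ?size_takel ?size_cat ?szE; lia.
Qed.

(** * Families with repeated blocks *)

(* The pattern [(u, P, v)] stands for all the words [u P ... P v]. *)
Definition pattern := (word * word * word)%type.

Definition expand m (t : pattern) := t.1.1 ++ flatten (nseq m t.1.2) ++ t.2.

Definition cyclic (T : Type) (pre loop : seq T) k := pre ++ flatten (nseq k loop).

(** Two copies of a loop of length at least 2 cover a window of three ladders, so three copies stand
    for all greater numbers; 0, 1 and 2 copies are tested separately. *)
Definition cycles_ok m (pre loop : seq (pattern)) :=
  all (fun k => cycle_ok ((size pre == 3) && (k == 0))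
                  (map (fun t => ends (expand m t)) (cyclic pre loop k)))
    (iota 0 4).

(** This makes the first three ladders, met again on closing the ring, independent of the number of
    loops. *)
Definition closes (T : eqType) (pre loop : seq T) :=
  (3 <= size pre) || (1 < size pre) && (loop == pre).

Lemma take_cyclic (T : eqType) (pre loop : seq T) k : closes pre loop ->
  take 3 (cyclic pre loop k ++ cyclic pre loop k) = take 3 (pre ++ pre).
Proof.
case/orP=> [pre3|/andP[pre2 /eqP->]]; first by rewrite /cyclic -catA !takel_cat.
have catE i : cyclic pre pre i = flatten (nseq i.+1 pre) by [].
rewrite catE -flatten_cat -nseqD -[_ ++ _]cats0 -[flatten _]cats0.
by rewrite !(@take_pump _ 3 _ _ 2) //= ?cats0 //; lia.
Qed.

Lemma family_colourable K l m pre loop k : K < 6 -> closes pre loop -> 1 < size loop ->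
  all (fun t => word_ok K.+1 l.+2 (expand m t)) (pre ++ loop) -> cycles_ok m pre loop ->
  packing_colourable (H_graph l (size pre + k * size loop)) K.+1.
Proof.
move=> K6 cl loop2; rewrite all_cat => /andP[preok loopok] cok.
have pre2 : 1 < size pre by case/orP: cl => [/ltnW|/andP[]].
have sz : size (map (expand m) (cyclic pre loop k)) = size pre + k * size loop.
  by rewrite size_map size_cat size_flatten /shape map_nseq sumn_nseq mulnC.
rewrite -sz; apply: cycle_colourable => //; rewrite ?sz; first by lia.
  rewrite all_map all_cat preok /=; elim: k {sz} => //= k IH; rewrite all_cat IH andbT.
  exact: loopok.
rewrite -map_comp -[_ \o _]/(fun t => ends (expand m t)).
have [k4|k3] := ltnP k 4.
  have := allP cok k; rewrite mem_iota add0n => /(_ k4).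
  suff -> : (size pre + k * size loop == 3) = (size pre == 3) && (k == 0) by [].
  by case: k {k4 sz} => [|k]; rewrite ?addn0 ?andbT // andbF; apply/negbTE; nia.
have -> : (size pre + k * size loop == 3) = false by apply/negbTE; nia.
have := allP cok 3 isT; rewrite andbF /cycle_ok.
(* The closing tail does not depend on [i], so the cyclic condition has a form that can be
   pumped. *)
set e := fun t => _; have cycE i : map e (cyclic pre loop i) ++
    take 3 (map e (cyclic pre loop i) ++ map e (cyclic pre loop i)) =
    map e pre ++ flatten (nseq i (map e loop)) ++ map e (take 3 (pre ++ pre)).
  rewrite -(take_cyclic i cl) -map_cat -map_take {1}/cyclic map_cat map_flatten map_nseq.
  by rewrite catA.
rewrite !cycE; apply: (@windows_pump _ 3 _ (link_ok_local _) 2); last exact: ltnW.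
by rewrite size_map (leq_trans _ (leq_mul (leqnn 2) loop2)).
Qed.

(** One block of six rows fills the window of [row_ok], so two copies stand for all greater
    numbers. *)
Lemma word_ok_pump K n m t : size t.1.2 = 6 ->
  all (fun i => word_ok K (n + i * 6) (expand i t)) (iota 0 3) ->
  word_ok K (n + m * 6) (expand m t).
Proof.
move=> szP ok; have [m3|m2] := ltnP m 3.
  by apply: (allP ok); rewrite mem_iota add0n.
have /and3P[/eqP sz2 w2 a2] := allP ok 2 isT.
have szE i : size (expand i t) = size t.1.1 + i * 6 + size t.2.
  by rewrite !size_cat size_flatten /shape map_nseq sumn_nseq szP mulnC addnA.
apply/and3P; split.
- by move: sz2; rewrite !szE; lia.
- by apply: (@windows_pump _ 6 _ row_ok_local 1) w2; rewrite ?szP; lia.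
move: a2; rewrite /expand /= !all_cat => /and3P[-> /andP[aP _] ->].
by rewrite andbT /=; elim: m {m2} => //= m IH; rewrite all_cat aP.
Qed.

Lemma ends_expand m t : 0 < m -> size t.1.2 = 6 -> ends (expand m t) = ends (expand 1 t).
Proof.
move=> m0 szP; suff E i : 0 < i -> ends (expand i t) =
    (take 6 (t.1.1 ++ take 6 (flatten (nseq 1 t.1.2))),
     take 6 (rev t.2 ++ take 6 (flatten (nseq 1 (rev t.1.2))))) by rewrite !E.
move=> i0; rewrite /ends /expand; congr (_, _).
  by rewrite -[LHS]take_cat_take (@take_pump _ 6 _ _ 1) ?szP.
rewrite !rev_cat -catA -[LHS]take_cat_take rev_flatten map_nseq rev_nseq.
by rewrite (@take_pump _ 6 _ _ 1) ?size_rev ?szP.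
Qed.

(** Every positive number of blocks gives the same six extreme rows, so the links are computed for 0
    and 1 blocks only. *)
Definition family_ok K n (pre loop : seq (pattern)) :=
  [&& closes pre loop, 1 < size loop, all (fun t => size t.1.2 == 6) (pre ++ loop),
      all (fun t => all (fun i => word_ok K (n + i * 6) (expand i t)) (iota 0 3)) (pre ++ loop),
      cycles_ok 0 pre loop & cycles_ok 1 pre loop].

Lemma family_ok_colourable K n pre loop m k : K < 6 -> family_ok K.+1 n.+2 pre loop ->
  packing_colourable (H_graph (n + m * 6) (size pre + k * size loop)) K.+1.
Proof.
move=> K6 /and5P[cl loop2 /allP sz6 ok /andP[c0 c1]]; apply: (@family_colourable K _ m) => //.
  apply/allP => t tin; rewrite -!addSn; apply: word_ok_pump; first exact/eqP/sz6.
  exact: (allP ok).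
case: m => [//|m]; suff -> : cycles_ok m.+1 pre loop = cycles_ok 1 pre loop by [].
rewrite /cycles_ok; apply: eq_all => i; congr cycle_ok.
apply/eq_in_map => t tin; apply: ends_expand => //; apply/eqP/sz6.
move: tin; rewrite /cyclic !mem_cat; case: (t \in pre) => //=.
by elim: i => //= i IH; rewrite mem_cat => /orP[].
Qed.

(* The two decimal digits of a number are the two colours of a row. *)
Definition word_of (s : seq nat) : word := [seq (n %/ 10, n %% 10) | n <- s].

Definition pat u P v : pattern := (word_of u, word_of P, word_of v).

Definition block_a := [:: 12; 41; 13; 21; 15; 31].
Definition block_b := [:: 13; 51; 12; 31; 14; 21].

(* In an entry [(n, a, b, s)], found by computer search, [a b ... a b] is a
   colouring with 5 colours and [s a b ... a b] one with 6 colours of the graphs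
   with [n + 6m] rows. *)
Definition families : seq (nat * pattern * pattern * seq pattern) := [::
  let a := pat [::] block_a block_a in
  let b := pat [::] block_b block_b in
  (6, a, b, [:: a; pat [::] block_b [:: 13; 51; 12; 41; 13; 61];
                pat [:: 16] [:: 21; 15; 31; 12; 41; 13] [:: 21; 15; 31; 14; 21]]);
  let a := pat [::] block_a (block_a ++ [:: 14; 21]) in
  let b := pat [::] block_b (block_b ++ [:: 15; 31]) in
  (8, a, b, [:: pat [:: 16; 21; 13; 41] [:: 12; 51; 13; 21; 14; 31] [:: 15; 21; 13; 61]; a; b]);
  let a := pat [::] block_a (block_a ++ [:: 12; 41; 13]) in
  let b := pat [::] block_b (block_b ++ [:: 13; 51; 12]) in
  (9, a, b, [:: a; pat [:: 61; 14; 23] [:: 51; 12; 31; 14; 21; 13] [:: 51; 12; 31; 14; 21; 15];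
                pat [:: 23] [:: 51; 12; 31; 14; 21; 13] [:: 51; 12; 31; 14; 21; 13; 61; 12]]);
  let a := pat [::] block_a [:: 12; 41; 13; 51; 12; 31; 14; 21; 15; 31] in
  let b := pat [::] block_b [:: 13; 51; 12; 41; 13; 21; 15; 31; 14; 21] in
  (10, a, b, [:: pat [:: 16] [:: 21; 13; 51; 12; 31; 14] [:: 21; 15; 31; 12; 41; 13; 51; 12; 61];
                 a; b]);
  let a := pat [::] block_a (block_a ++ [:: 12; 41; 13; 51; 12]) in
  let b := pat [::] block_b (block_b ++ [:: 13; 51; 12; 41; 13]) in
  (11, a, b, [:: pat [::] block_a (block_a ++ [:: 12; 41; 13; 21; 15]);
                 pat [::] block_b (block_b ++ [:: 13; 61; 12; 31; 14]);
                 pat [:: 16] [:: 21; 15; 31; 12; 41; 13]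
                     [:: 21; 15; 31; 12; 41; 13; 51; 16; 21; 13]]);
  let a := pat [::] block_a (block_a ++ [:: 14; 21; 13; 51; 12; 41; 13]) in
  let b := pat [::] block_b (block_b ++ [:: 15; 31; 12; 41; 13; 51; 12]) in
  (13, a, b, [:: pat [:: 16] [:: 21; 13; 41; 12; 31; 15]
                     [:: 21; 13; 41; 12; 31; 15; 21; 13; 41; 12; 31; 16]; a; b])].

Lemma families_ok :
  all (fun x => let: (n, a, b, s) := x in
    [&& size s == 3, family_ok 5 n [:: a; b] [:: a; b] & family_ok 6 n s [:: a; b]]) families.
Proof. by vm_compute. Qed.

Lemma families_cover l : 3 < l -> l != 5 ->
  exists m n a b s, l.+2 = n.+2 + m * 6 /\ (n.+2, a, b, s) \in families.
Proof.
move=> l3 l5; have rmem x : x \in families -> (x.1.1.1.-2.+2, x.1.1.2, x.1.2, x.2) \in families.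
  by move: x; apply/allP; vm_compute.
pose p0 : pattern := ([::], [::], [::]).
(* The index list sends the residue of the number of rows to its entry. Residues 1 and 5 start at 13
   and 11 rows, which leaves out 7 and 5 rows, that is [l = 5] and [l = 3]. *)
pose x := nth (0, p0, p0, [::]) families (nth 0 [:: 0; 5; 1; 2; 3; 4] (l.+2 %% 6)).
exists ((l.+2 - x.1.1.1) %/ 6), x.1.1.1.-2, x.1.1.2, x.1.2, x.2.
have lt6 : l.+2 %% 6 < 6 by rewrite ltn_mod.
split; last by apply: rmem; rewrite mem_nth //; case: (_ %% _) lt6 => [|[|[|[|[|[]]]]]].
have := divn_eq l.+2 6; rewrite /x.
by case: (_ %% _) lt6 => [|[|[|[|[|[]]]]]] //= _; lia.
Qed.

(** * The case of five rows, [l = 3] *)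

Definition fixed s := pat s [::] [::].

Definition l3_even := [:: fixed [:: 12; 41; 13; 51; 12]; fixed [:: 13; 51; 12; 41; 13]].

Definition l3_r3 := [::
  word_of [:: 12; 31; 14; 21; 13]; word_of [:: 51; 13; 21; 14; 61];
  word_of [:: 26; 41; 12; 31; 25]].

Definition l3_loop_r1mod4 := [:: fixed [:: 61; 14; 23; 51; 12]; fixed [:: 23; 51; 12; 41; 13];
  fixed [:: 12; 41; 23; 51; 12]; fixed [:: 13; 51; 12; 41; 13]].

(** Starting with the first three ladders of the loop makes closing the ring look like entering
    another loop. *)
Definition l3_pre_r1mod4 := take 3 l3_loop_r1mod4 ++
  [:: fixed [:: 15; 31; 12; 41; 16]; fixed [:: 12; 31; 14; 21; 13]].

Definition l3_loop_r3mod4 := [:: fixed [:: 12; 51; 16; 41; 12]; fixed [:: 13; 41; 12; 51; 13];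
  fixed [:: 12; 51; 23; 41; 12]; fixed [:: 13; 41; 62; 51; 13]].

Definition l3_pre_r3mod4 := take 3 l3_loop_r3mod4 ++
  [:: fixed [:: 16; 41; 12; 31; 15]; fixed [:: 13; 21; 14; 31; 12];
      fixed [:: 12; 51; 23; 14; 61]; fixed [:: 13; 41; 12; 51; 23]].

Lemma even_colourable l r : 3 <= l -> l != 5 -> 2 <= r -> ~~ odd r ->
  packing_colourable (H_graph l r) 5.
Proof.
move=> l3 l5 r2 rev; have [k ->] : exists k, r = 2 + k * 2 by exists (r./2).-1; lia.
have [->|l3'] := eqVneq l 3.
  by apply: (@family_colourable 4 3 0 l3_even l3_even) => //; vm_compute.
have [||m [n [a [b [s [lE /(allP families_ok) /and3P[_ ok _]]]]]]] := @families_cover l => //.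
  by lia.
have -> : l = n + m * 6 by lia.
exact: (family_ok_colourable m k _ ok).
Qed.

Lemma odd_colourable l r : 3 <= l -> l != 5 -> 2 <= r -> odd r ->
  packing_colourable (H_graph l r) 6.
Proof.
move=> l3 l5 r2 rodd; have [->|l3'] := eqVneq l 3.
  have [->|r3] := eqVneq r 3.
    by apply: (@cycle_colourable 5 3 l3_r3) => //; vm_compute.
  have [r1|r1] := eqVneq (r %% 4) 1.
    have -> : r = 5 + ((r - 5) %/ 4) * 4 by lia.
    by apply: (@family_colourable 5 3 0 l3_pre_r1mod4 l3_loop_r1mod4) => //; vm_compute.
  (* The remaining [r] are 3 modulo 4 and differ from 3, hence are at least 7. *)
  have -> : r = 7 + ((r - 7) %/ 4) * 4 by lia.
  by apply: (@family_colourable 5 3 0 l3_pre_r3mod4 l3_loop_r3mod4) => //; vm_compute.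
have [||m [n [a [b [s [lE /(allP families_ok) /and3P[/eqP s3 _ ok]]]]]]] := @families_cover l => //.
  by lia.
have -> : l = n + m * 6 by lia.
(* The three ladders of [s] absorb the odd parity; the others come in pairs. *)
have -> : r = size s + (r./2).-1 * 2 by rewrite s3; lia.
exact: (family_ok_colourable m _ _ ok).
Qed.

Lemma packing_chromatic_number_eq (G : sgraph) k : packing_colourable G k ->
  (forall j, j < k -> ~~ packing_colourable G j) -> packing_chromatic_number G = k.
Proof.
move=> Gk Gj; rewrite /packing_chromatic_number; case: ex_minnP => n Gn /(_ _ Gk).
by rewrite leq_eqVlt => /predU1P[//|/Gj/negP].
Qed.

Theorem theorem17 (l r : nat) (hl : 3 <= l) (hl5 : l <> 5) (hr : 2 <= r) :
  (~~ odd r -> packing_chromatic_number (H_graph l r) = 5) /\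
  (odd r -> packing_chromatic_number (H_graph l r) = 6).
Proof.
have l5 : l != 5 by apply/eqP.
have l2 : 2 <= l by apply: ltnW.
split=> r_parity; apply: packing_chromatic_number_eq => [|j jk].
- exact: even_colourable.
- exact: not_4_colourable.
- exact: odd_colourable.
exact: not_5_colourable.
Qed.
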